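(* Let $l,m,n$ be nonnegative integers. Then $$\sum_{k=0}^l(-1)^{m-k}\binom{l}{k}\binom{m-k}{n}\binom{2k}{k-2l+m} =\sum_{k=0}^l\binom lk\binom{2k}n\binom{n-l}{m+n-3k-l}.$$
   Context: For any (real or complex) number $x$ and integer $k$, the binomial coefficient is defined by $\binom xk=\frac1{k!}\prod_{j=0}^{k-1}(x-j)$ if $k>0$, $\binom x0=1$, and $\binom xk=0$ if $k<0$. In particular the upper argument may be negative (e.g. $n-l<0$). *)

(* Defs.v *)
From HB Require Import structures.
From mathcomp Require Import all_boot all_order all_algebra.

Set Implicit Arguments.
Unset Strict Implicit.
Unset Printing Implicit Defensive.

Import Order.TTheory GRing.Theory Num.Theory.
Local Open Scope ring_scope.

(* Generalized binomial coefficient; for k = 0 the empty product gives 1, and *)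
(* Negz covers exactly the integers k < 0.                                    *)
Definition gbinom (F : numFieldType) (x : F) (k : int) : F :=
  match k with
  | Posz n => (n`!)%:R^-1 * \prod_(0 <= j < n) (x - j%:R)
  | Negz _ => 0
  end.

(* Main.v *)
Require Import Defs.
From HB Require Import structures.
From mathcomp Require Import all_boot all_order all_algebra.
From mathcomp Require Import zify ring.

Set Implicit Arguments.
Unset Strict Implicit.
Unset Printing Implicit Defensive.

Import Order.TTheory GRing.Theory Num.Theory.
Local Open Scope ring_scope.

(** Both sides are the coefficient of [x^m y^n] in [(x W)^l], where
    [W = 1 - x + x y^2 + x^2 (1 + y)^2].  The left-hand side comes from
    [W = x z^2 + (1 - x z)^2] with [z = 1 + y], extracting [x^m] first; the
    right-hand side from [(1 + x) W = 1 + x (x + (1 + x) y)^2], extracting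
    [y^n] first.  Each power [y^n] there carries a factor [(1 + x)^n], and
    dividing by [(1 + x)^l] leaves [(1 + x)^(n - l)], possibly with a negative
    exponent.  This power is realized as a binomial series truncated at an
    order above [m]: by Pascal's rule, multiplying the truncation by [1 + x]
    raises the exponent by one, up to a term that does not reach the
    coefficient of [x^m]. *)

Section GeneralizedBinomial.

Variable F : numFieldType.
Implicit Types (x : F) (k : int).

Lemma gbinom0 x : gbinom x 0 = 1.
Proof. by rewrite /= big_geq // mulr1 invr1. Qed.

Lemma gbinom_lt0 x k : k < 0 -> gbinom x k = 0.
Proof. by case: k. Qed.

Lemma gbinom_pascal x k : gbinom (x + 1) k = gbinom x k + gbinom x (k - 1).
Proof.
case: k => [[|k]|k]; [by rewrite !gbinom0 addr0 | | by rewrite /= addr0].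
have -> : k.+1%:Z - 1 = k%:Z by lia.
rewrite /= big_nat_recl // big_nat_recr //= subr0.
under eq_bigr => j _ do rewrite -natr1 opprD addrACA subrr addr0.
have fact_neq0 : (k`!)%:R != 0 :> F by rewrite pnatr_eq0 -lt0n fact_gt0.
have k1_neq0 : k%:R + 1 != 0 :> F by rewrite natr1 pnatr_eq0.
by rewrite factS natrM -natr1; field; rewrite fact_neq0.
Qed.

Lemma gbinom_nat (a k : nat) : gbinom (a%:R : F) k%:Z = 'C(a, k)%:R.
Proof.
elim: a k => [|a IHa] [|k]; rewrite ?[gbinom _ 0]gbinom0 ?bin0 //.
  by rewrite /= big_nat_recl // subrr mul0r mulr0.
have predk : k.+1%:Z - 1 = k%:Z by lia.
by rewrite -natr1 gbinom_pascal predk binS natrD !IHa.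
Qed.

Lemma gbinom_subz x (m e : nat) :
  gbinom x (m%:Z - e%:Z) = if (m < e)%N then 0 else gbinom x (m - e)%N%:Z.
Proof.
case: ltnP => [lt_me | le_em]; last by rewrite subzn.
by rewrite gbinom_lt0 // subr_lt0 ltz_nat.
Qed.

End GeneralizedBinomial.

Local Arguments gbinom : simpl never.

Section TruncatedBinomialSeries.

Variable F : numFieldType.
Implicit Types (x : F) (N : nat).

Definition trunc_binomial_series N x : {poly F} :=
  \poly_(k < N) gbinom x k%:Z.

Lemma trunc_binomial_series0 N : trunc_binomial_series N.+1 0 = 1.
Proof.
apply/polyP=> k; rewrite coef_poly coef1 (gbinom_nat F 0) bin0n.
by case: k => [|k] //=; rewrite if_same.
Qed.

Lemma coef_XnM_trunc_binomial_series N x (e m : nat) : (m < N)%N ->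
  ('X^e * trunc_binomial_series N x)`_m = gbinom x (m%:Z - e%:Z).
Proof.
move=> lt_mN; rewrite coefXnM gbinom_subz coef_poly.
by rewrite (leq_ltn_trans (leq_subr e m) lt_mN).
Qed.

Lemma mul_1DX_trunc_binomial_series N x :
  (1 + 'X) * trunc_binomial_series N x
    = trunc_binomial_series N (x + 1) + gbinom x (N%:Z - 1) *: 'X^N.
Proof.
rewrite /trunc_binomial_series !poly_def.
elim: N => [|N IHN]; first by rewrite !big_ord0 scale0r mulr0 addr0.
have predN : N.+1%:Z - 1 = N%:Z by lia.
rewrite !big_ord_recr /= mulrDr IHN predN gbinom_pascal exprS -!mul_polyC.
by rewrite polyCD; ring.
Qed.

Lemma coef_mul_1DXn_trunc_binomial_series N x (p : {poly F}) (a m : nat) :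
    (m < N)%N ->
  (p * (1 + 'X) ^+ a * trunc_binomial_series N x)`_m
    = (p * trunc_binomial_series N (x + a%:R))`_m.
Proof.
move=> lt_mN; elim: a x => [|a IHa] x; first by rewrite mulr1 addr0.
rewrite exprSr mulrA -mulrA mul_1DX_trunc_binomial_series mulrDr coefD.
rewrite -scalerAr coefZ coefMXn lt_mN mulr0 addr0 IHa.
by rewrite -addrA -natr1 [1 + _]addrC.
Qed.

Lemma coef_quotient_1DXn (A B : {poly F}) (l n m : nat) :
    (1 + 'X) ^+ l * A = B * (1 + 'X) ^+ n ->
  A`_m = (B * trunc_binomial_series m.+1 (n%:R - l%:R))`_m.
Proof.
move=> eqAB; rewrite [_ - _]addrC -coef_mul_1DXn_trunc_binomial_series // -eqAB.
rewrite [_ * A]mulrC coef_mul_1DXn_trunc_binomial_series // addNr.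
by rewrite trunc_binomial_series0 mulr1.
Qed.

End TruncatedBinomialSeries.

Lemma coef_linear_exp (R : comNzRingType) (a b : R) (N i : nat) :
  ((a%:P + b%:P * 'X) ^+ N)`_i = a ^+ (N - i) * b ^+ i *+ 'C(N, i).
Proof.
have -> : (a%:P + b%:P * 'X) ^+ N
    = \poly_(j < N.+1) (a ^+ (N - j) * b ^+ j *+ 'C(N, j)).
  rewrite exprDn poly_def; apply: eq_bigr => j _.
  by rewrite exprMn mulrA -!polyC_exp -polyCM mul_polyC scalerMnl.
by rewrite coef_poly; case: leqP => // lt_Ni; rewrite bin_small.
Qed.

Lemma coef_1DXn (R : comNzRingType) (N i : nat) :
  ((1 + 'X : {poly R}) ^+ N)`_i = 'C(N, i)%:R.
Proof.
have -> : 1 + 'X = 1%:P + 1%:P * 'X :> {poly R} by rewrite mul1r.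
by rewrite coef_linear_exp !expr1n mulr1.
Qed.

Definition genpoly (R : comNzRingType) (x y : R) : R :=
  x * (1 - x + x * y ^+ 2 + x ^+ 2 * (1 + y) ^+ 2).

Lemma rmorph_genpoly (R S : comNzRingType) (f : {rmorphism R -> S}) (x y : R) :
  f (genpoly x y) = genpoly (f x) (f y).
Proof. by rewrite /genpoly !(rmorphM, rmorphD, rmorphN, rmorphXn, rmorph1). Qed.

Lemma genpolyXn (R : comNzRingType) (x y : R) (l : nat) :
  genpoly x y ^+ l = \sum_(k < l.+1)
    x ^+ (2 * l - k) * ((1 + y) ^+ (2 * (l - k)) * (1 - x * (1 + y)) ^+ (2 * k))
      *+ 'C(l, k).
Proof.
have -> : genpoly x y = (x * (1 + y)) ^+ 2 + x * (1 - x * (1 + y)) ^+ 2.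
  by rewrite /genpoly; ring.
rewrite exprDn; apply: eq_bigr => k _; congr (_ *+ _).
have -> : (2 * l - k = 2 * (l - k) + k)%N by have := ltn_ord k; lia.
by rewrite exprD !exprM !exprMn; ring.
Qed.

Lemma mul_1D_genpolyXn (R : comNzRingType) (x y : R) (l : nat) :
  (1 + x) ^+ l * genpoly x y ^+ l = \sum_(k < l.+1)
    x ^+ (l + k) * (x + (1 + x) * y) ^+ (2 * k) *+ 'C(l, k).
Proof.
have genpolyM : (1 + x) * genpoly x y = x + x ^+ 2 * (x + (1 + x) * y) ^+ 2.
  by rewrite /genpoly; ring.
rewrite -exprMn genpolyM exprDn; apply: eq_bigr => k _; congr (_ *+ _).
have -> : (l + k = l - k + 2 * k)%N by have := ltn_ord k; lia.
by rewrite exprD !exprM !exprMn; ring.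
Qed.

Lemma coef_genpolyXn_x (R : comNzRingType) (y : R) (l m : nat) :
  (genpoly 'X y%:P ^+ l)`_m = \sum_(k < l.+1)
    (if (m < 2 * l - k)%N then 0 else
     (- (1 + y)) ^+ (m - k) *+ 'C(2 * k, m - (2 * l - k))) *+ 'C(l, k).
Proof.
rewrite genpolyXn coef_sum; apply: eq_bigr => k _.
have le_kl : (k <= l)%N by rewrite -ltnS.
rewrite coefMn coefXnM; congr (_ *+ _); case: ltnP => // le_m.
have -> : 1 - 'X * (1 + y%:P) = 1%:P + (- (1 + y))%:P * 'X.
  by rewrite polyCN polyCD; ring.
rewrite -polyCD -polyC_exp coefCM coef_linear_exp expr1n mul1r mulrnAr.
have -> : (m - k = 2 * (l - k) + (m - (2 * l - k)))%N by lia.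
by rewrite [in RHS]exprD !exprM sqrrN.
Qed.

(* The subtraction in [3 * k + l - n] truncates only if ['C(2 * k, n) = 0]. *)
Lemma mul_coef_genpolyXn_y (R : comNzRingType) (x : R) (l n : nat) :
  (1 + x) ^+ l * (genpoly x%:P 'X ^+ l)`_n
    = (\sum_(k < l.+1) x ^+ (3 * k + l - n) *+ 'C(2 * k, n) *+ 'C(l, k))
      * (1 + x) ^+ n.
Proof.
rewrite -coefCM polyC_exp polyCD mul_1D_genpolyXn coef_sum mulr_suml.
apply: eq_bigr => k _; rewrite -polyCD -polyC_exp coefMn coefCM coef_linear_exp.
rewrite mulrnAr mulrA -exprD !mulrnAl.
have [lt_kn | le_nk] := ltnP (2 * k) n; first by rewrite bin_small.
congr (_ ^+ _ * _ *+ _ *+ _); by have := ltn_ord k; lia.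
Qed.

Lemma coef_genpolyXn_xy (F : numFieldType) (l n m : nat) :
  (genpoly 'X ('X : {poly F})%:P ^+ l)`_m`_n = \sum_(k < l.+1)
    (-1) ^ (m%:Z - k%:Z) * gbinom (l%:R : F) k%:Z
      * gbinom (m%:R - k%:R : F) n%:Z
      * gbinom ((2 * k)%:R : F) (k%:Z - 2 * l%:Z + m%:Z).
Proof.
rewrite coef_genpolyXn_x coef_sum; apply: eq_bigr => k _.
have le_kl : (k <= l)%N by rewrite -ltnS.
have -> : k%:Z - 2 * l%:Z + m%:Z = m%:Z - (2 * l - k)%N%:Z by lia.
rewrite gbinom_subz coefMn; case: ltnP => [_ | le_m].
  by rewrite coef0 mulr0 mul0rn.
have le_km : (k <= m)%N by lia.
rewrite -natrB // subzn // !gbinom_nat -exprnP exprNn -(rmorph_sign polyC).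
by rewrite coefMn coefCM coef_1DXn; ring.
Qed.

Lemma coef_genpolyXn_yx (F : numFieldType) (l n m : nat) :
  (genpoly ('X : {poly F})%:P 'X ^+ l)`_n`_m = \sum_(k < l.+1)
    gbinom (l%:R : F) k%:Z * gbinom ((2 * k)%:R : F) n%:Z
      * gbinom (n%:R - l%:R : F) (m%:Z + n%:Z - 3 * k%:Z - l%:Z).
Proof.
rewrite (coef_quotient_1DXn m (mul_coef_genpolyXn_y 'X l n)).
rewrite mulr_suml coef_sum; apply: eq_bigr => k _.
rewrite !mulrnAl !coefMn coef_XnM_trunc_binomial_series // !gbinom_nat.
rewrite -mulrA !mulr_natl.
have [lt_kn | le_nk] := ltnP (2 * k) n; first by rewrite (bin_small lt_kn).
congr (gbinom _ _ *+ _ *+ _); by have := ltn_ord k; lia.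
Qed.

Theorem theorem1p1 (F : numFieldType) (l m n : nat) :
  \sum_(0 <= k < l.+1)
     (-1) ^ (m%:Z - k%:Z) * gbinom (l%:R : F) k%:Z
       * gbinom (m%:R - k%:R : F) n%:Z
       * gbinom ((2 * k)%:R : F) (k%:Z - 2 * l%:Z + m%:Z)
  = \sum_(0 <= k < l.+1)
     gbinom (l%:R : F) k%:Z * gbinom ((2 * k)%:R : F) n%:Z
       * gbinom (n%:R - l%:R : F) (m%:Z + n%:Z - 3 * k%:Z - l%:Z).
Proof.
rewrite !big_mkord -coef_genpolyXn_xy -coef_genpolyXn_yx -coef_swapXY.
by rewrite rmorphXn rmorph_genpoly /= swapXY_X swapXY_Y.
Qed.
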